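(* Let $f(x)=x^4+a_2x^2+a_1x+a_0$ with real coefficients such that $a_1\neq0$ and $a_2<0$, and let $\mu$ be the Steklov function associated with $f$. Then $\mu(\cdot,t_0)$ is convex on $\mathbb{R}$ for $t_0:=\sqrt{-a_2/2}$, and the unique (global) minimizer of $\mu(\cdot,t_0)$ is $x_0:=-\sqrt[3]{a_1/4}$.
   Context: The Steklov function associated with $f$ is $\mu(x,t):=\frac{1}{2t}\int_{x-t}^{x+t}f(\tau)\,d\tau$ for $x\in\mathbb{R}$, $t>0$. Cube roots are real cube roots. *)

(* Defs.v *)
From Stdlib Require Import Reals Lra.
From Coquelicot Require Import Coquelicot.
Open Scope R_scope.

(* [RInt] is total, but it is the Riemann integral for every [f] integrable on
   the interval, in particular for continuous [f]; the notion is meant for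
   [0 < t]. *)
Definition steklov (f : R -> R) (x t : R) : R :=
  / (2 * t) * RInt f (x - t) (x + t).

(* The factor [sign x] vanishes at 0, where [Rpower] is meaningless. *)
Definition cbrt (x : R) : R := sign x * Rpower (Rabs x) (1 / 3).

Lemma cbrt_pow3 (x : R) : cbrt x ^ 3 = x.
Proof.
assert (H : forall y, 0 < y -> Rpower y (1 / 3) ^ 3 = y).
{ intros y Hy.
  rewrite <- Rpower_pow by apply exp_pos.
  rewrite Rpower_mult.
  replace (1 / 3 * INR 3) with 1 by (simpl; field).
  now apply Rpower_1. }
unfold cbrt; rewrite Rpow_mult_distr.
destruct (Rtotal_order x 0) as [Hx | [-> | Hx]].
- rewrite sign_eq_m1, Rabs_left, H by lra; ring.
- rewrite sign_0; ring.
- rewrite sign_eq_1, Rabs_right, H by lra; ring.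
Qed.

Definition convex_on_R (g : R -> R) : Prop :=
  forall x y l : R, 0 <= l <= 1 ->
    g (l * x + (1 - l) * y) <= l * g x + (1 - l) * g y.

Definition global_minimizer (g : R -> R) (x : R) : Prop :=
  forall y : R, g x <= g y.

(* Main.v *)
Require Import Defs.
From Stdlib Require Import Reals Lra.
From Coquelicot Require Import Coquelicot.
Open Scope R_scope.

(** The Steklov average of half-width [t] replaces [x ^ 4] by
    [x ^ 4 + 2 * t ^ 2 * x ^ 2 + t ^ 4 / 5] and [x ^ 2] by [x ^ 2 + t ^ 2 / 3],
    and it fixes affine functions ([steklov_quartic]).  The total coefficient of
    [x ^ 2] in the average of the quartic is therefore [2 * t ^ 2 + a2], and
    [t0 = sqrt (- a2 / 2)] is the half-width at which it vanishes: the average is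
    then [x ^ 4 + a1 * x] up to a constant ([steklov_quartic_critical]).

    For such a depressed quartic, both claims follow from the fact that the
    graph of [x ^ 4] lies above each of its tangents and meets it only at the
    point of tangency ([pow4_above_tangent], [pow4_tangent_contact]).  Convexity
    is the average of two tangent inequalities taken at [l * x + (1 - l) * y].
    Moreover [- a1] is the slope [4 * c ^ 3] of the tangent at
    [c = - cbrt (a1 / 4)], so [x ^ 4 + a1 * x] is, up to a constant, the height
    of the graph above that tangent, which is least at [c] alone. *)

Lemma steklov_quartic (a2 a1 a0 x t : R) : 0 < t ->
  steklov (fun x => x ^ 4 + a2 * x ^ 2 + a1 * x + a0) x t =
  x ^ 4 + (2 * t ^ 2 + a2) * x ^ 2 + a1 * x
  + (t ^ 4 / 5 + a2 * t ^ 2 / 3 + a0).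
Proof.
intros Ht; unfold steklov.
set (F := fun s : R => s ^ 5 / 5 + a2 * s ^ 3 / 3 + a1 * s ^ 2 / 2 + a0 * s).
rewrite (is_RInt_unique _ (x - t) (x + t) (F (x + t) - F (x - t))).
- unfold F; field; lra.
- apply (is_RInt_derive F).
  + intros s _; unfold F; auto_derive; [easy | simpl; field].
  + intros s _; apply (ex_derive_continuous (K := R_AbsRing) (V := R_NormedModule)).
    auto_derive; easy.
Qed.

Lemma steklov_quartic_critical (a2 a1 a0 x : R) : a2 < 0 ->
  steklov (fun x => x ^ 4 + a2 * x ^ 2 + a1 * x + a0) x (sqrt (- a2 / 2)) =
  x ^ 4 + a1 * x + (a0 - 7 * a2 ^ 2 / 60).
Proof.
intros Ha2.
assert (Ht : 0 < sqrt (- a2 / 2)) by (apply sqrt_lt_R0; lra).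
assert (Ht2 : sqrt (- a2 / 2) ^ 2 = - a2 / 2) by (apply pow2_sqrt; lra).
rewrite steklov_quartic by exact Ht.
replace (sqrt (- a2 / 2) ^ 4) with ((sqrt (- a2 / 2) ^ 2) ^ 2) by ring.
rewrite Ht2; field.
Qed.

(** The tangent at [c] has a double contact with the quartic, which leaves a
    quadratic factor; that factor is a sum of two squares. *)
Lemma pow4_sub_tangent (c y : R) :
  y ^ 4 - (c ^ 4 + 4 * c ^ 3 * (y - c)) =
  (y - c) ^ 2 * ((y + c) ^ 2 + 2 * c ^ 2).
Proof. ring. Qed.

Lemma pow4_above_tangent (c y : R) : c ^ 4 + 4 * c ^ 3 * (y - c) <= y ^ 4.
Proof.
apply Rminus_le_0; rewrite pow4_sub_tangent.
pose proof (pow2_ge_0 (y + c)); pose proof (pow2_ge_0 c).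
apply Rmult_le_pos; [apply pow2_ge_0 | lra].
Qed.

(** The cofactor [(y + c) ^ 2 + 2 * c ^ 2] can vanish only when [c = 0] and
    [y = 0], so it yields no second point of contact. *)
Lemma pow4_tangent_contact (c y : R) :
  y ^ 4 <= c ^ 4 + 4 * c ^ 3 * (y - c) -> y = c.
Proof.
intros Hle.
assert (H0 : (y - c) ^ 2 * ((y + c) ^ 2 + 2 * c ^ 2) = 0).
{ rewrite <- pow4_sub_tangent; pose proof (pow4_above_tangent c y); lra. }
destruct (Rmult_integral _ _ H0) as [H | H].
- nra.
- pose proof (pow2_ge_0 (y + c)); pose proof (pow2_ge_0 c).
  assert (Hc : c = 0) by nra.
  nra.
Qed.

Lemma depressed_quartic_convex (a b : R) :
  convex_on_R (fun x => x ^ 4 + a * x + b).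
Proof.
intros x y l Hl; cbv beta.
set (c := l * x + (1 - l) * y).
pose proof (Rmult_le_compat_l l _ _ (proj1 Hl) (pow4_above_tangent c x)) as Hx.
assert (Hl' : 0 <= 1 - l) by lra.
pose proof (Rmult_le_compat_l (1 - l) _ _ Hl' (pow4_above_tangent c y)) as Hy.
(* The slope terms cancel because [c] is the barycentre of [x] and [y]. *)
assert (Hc : l * (c ^ 4 + 4 * c ^ 3 * (x - c))
             + (1 - l) * (c ^ 4 + 4 * c ^ 3 * (y - c)) = c ^ 4)
  by (unfold c; ring).
assert (Ha : a * c = l * (a * x) + (1 - l) * (a * y)) by (unfold c; ring).
lra.
Qed.

Lemma depressed_quartic_unique_minimizer (a b : R) :
  unique (global_minimizer (fun x => x ^ 4 + a * x + b)) (- cbrt (a / 4)).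
Proof.
set (c := - cbrt (a / 4)).
assert (Ha : a = - 4 * c ^ 3).
{ replace (c ^ 3) with (- cbrt (a / 4) ^ 3) by (unfold c; ring).
  rewrite cbrt_pow3; field. }
clearbody c; subst a.
split.
- intros y; pose proof (pow4_above_tangent c y); nra.
- intros y Hy; symmetry; apply pow4_tangent_contact.
  specialize (Hy c); cbv beta in Hy; nra.
Qed.

Theorem lemma5 :
  forall a2 a1 a0 : R, a1 <> 0 -> a2 < 0 ->
    let f := fun x : R => x ^ 4 + a2 * x ^ 2 + a1 * x + a0 in
    let t0 := sqrt (- a2 / 2) in
    let x0 := - cbrt (a1 / 4) in
    convex_on_R (fun x : R => steklov f x t0) /\
    unique (global_minimizer (fun x : R => steklov f x t0)) x0.
Proof.
intros a2 a1 a0 _ Ha2 f t0 x0.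
set (b := a0 - 7 * a2 ^ 2 / 60).
assert (Hmu : forall x, steklov f x t0 = x ^ 4 + a1 * x + b)
  by (intros x; now apply steklov_quartic_critical).
split.
- intros x y l Hl; rewrite !Hmu; now apply depressed_quartic_convex.
- destruct (depressed_quartic_unique_minimizer a1 b) as [Hmin Huniq].
  split.
  + intros y; rewrite !Hmu; apply Hmin.
  + intros x Hx; apply Huniq; intros y; rewrite <- !Hmu; apply Hx.
Qed.
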